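(* Fix an integer $d \geq 3$, nonzero integers $a_1, a_2, \ldots, a_d$ satisfying $a_1 + \cdots + a_d = 0$, and a real number $0 < \varepsilon < 1$. Then there exists $N_0 = N_0(d, a_1, \ldots, a_d, \varepsilon)$ such that the following holds for all primes $N \geq N_0$. Suppose $f : \mathbb{Z}/N\mathbb{Z} \to [0,1]$ satisfies $$\sum_{n \in \mathbb{Z}/N\mathbb{Z}} f(n) = \theta N > 0,$$ and has the property that for some integer $k$ satisfying $$1000^{d \varepsilon^{-1}}\, \theta^{-(\varepsilon d)^{-1}} \log N \;\leq\; k \;\leq\; N^{1/11},$$ we have $$\sum_{k \leq j \leq N} |\lambda_j|^2 \;<\; k^{-(4+10\varepsilon)(d-2)}\, \sigma^2 \;\leq\; k^{-(4+10\varepsilon)(d-2)}\, \theta N^2,$$ where $\lambda_1, \ldots, \lambda_N$ are the Fourier coefficients of $f$ listed in non-increasing order of absolute value and $\sigma^2 = \sum_{j=1}^N |\lambda_j|^2$ (the second inequality here is automatic by Parseval). Then $$\sum_{\substack{x_1, \ldots, x_d \in \mathbb{Z}/N\mathbb{Z} \\ a_1 x_1 + \cdots + a_d x_d \equiv 0 \ (\mathrm{mod}\ N)}} f(x_1) \cdots f(x_d) \;>\; 10^{-1}\, 4^{-d}\, k^{-2(d-2) - 2\varepsilon(d - 3/2)}\, \theta\, (\theta N)^{d-1}.$$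
   Context: For $f : \mathbb{Z}/N\mathbb{Z} \to [0,1]$ and $a \in \mathbb{Z}/N\mathbb{Z}$, the Fourier transform is unnormalized: $\hat f(a) := \sum_{n \in \mathbb{Z}/N\mathbb{Z}} f(n)\, \omega^{an}$, where $\omega = e^{2\pi i/N}$. The numbers $\lambda_1, \ldots, \lambda_N$ are the $N$ Fourier coefficients $\hat f(a)$, $a \in \mathbb{Z}/N\mathbb{Z}$ (counted with multiplicity), ordered so that $|\hat f(0)| = |\lambda_1| \geq |\lambda_2| \geq \cdots \geq |\lambda_N|$. One sets $\sigma^2 := \sum_{j=1}^N |\lambda_j|^2 = N \sum_n |f(n)|^2 \leq \theta N^2$, where the second equality is Parseval's identity. The density is $\theta = N^{-1}\sum_n f(n)$, and $\log$ is the natural logarithm. *)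

(* Defs.v *)
From mathcomp Require Import all_boot all_order all_algebra.
From mathcomp Require Import all_classical all_reals all_analysis.
From mathcomp Require Import complex.

Set Implicit Arguments.
Unset Strict Implicit.
Unset Printing Implicit Defensive.

Import Order.TTheory GRing.Theory Num.Theory.

Local Open Scope ring_scope.
Local Open Scope complex_scope.

(* 'Z_N stands for Z/NZ, which is only correct for N > 1. *)

Definition omega (R : realType) (N : nat) : R[i] :=
  cos (2 * pi / N%:R) +i* sin (2 * pi / N%:R).

(* The exponent multiplies the representatives of a and n in {0, ..., N - 1};
   this is harmless since omega R N ^+ N = 1. *)
Definition fourier (R : realType) (N : nat) (f : 'Z_N -> R) (a : 'Z_N) : R[i] :=
  \sum_(n : 'Z_N) (f n)%:C * omega R N ^+ (a * n)%N.

(* The real-valued modulus; `|z| would live in R[i]. *)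
Definition cabs (R : realType) (z : R[i]) : R := Normc.normc z.

(* lam lists all Fourier coefficients of f, with multiplicity, by non-increasing
   modulus; ties may be broken arbitrarily. *)
Definition fourier_listing (R : realType) (N : nat) (f : 'Z_N -> R)
    (lam : seq R[i]) : Prop :=
  perm_eq lam [seq fourier f a | a : 'Z_N] /\
  sorted (fun z w : R[i] => cabs w <= cabs z) lam.

(* lambda_j for 1 <= j <= size lam: the mathematical indexing starts at 1. *)
Definition coef (R : realType) (lam : seq R[i]) (j : nat) : R[i] :=
  nth 0 lam j.-1.

(* Main.v *)
(* Write [f = g + e], where [g] keeps the [k - 1] largest Fourier coefficients and
   [e] is small in L^2. Solve the equation for [x_1], as [x_1 = L (x_2, .., x_d)], and
   free one of [x_3, .., x_d]: the resulting functions [x |-> g (L (.., x, ..))] all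
   lie in one space spanned by [Q < d k] characters. Among [Q + 1] random points
   some linear dependency has a point with maximal coefficient, so by symmetry the
   value at a point [y] is bounded, with average probability at least
   [1 / (Q + 1)], by the sum of the values at the [Q] other points. Starting from
   the trivial solution [x_1 = .. = x_d = y] (the coefficients sum to [0]) and
   freeing [x_3, .., x_d] one at a time, each step costs a factor of order
   [(d k) ^ 2], so there are about
   [theta (theta N) ^ (d - 1) (d k) ^ (- 2 (d - 2))] solutions. The points are drawn
   with weight [u = f] on the set [f >= theta / 2], where the trivial solution
   contributes at least [theta / 2]. *)

Require Import Defs.
From mathcomp Require Import all_boot all_order all_algebra.
From mathcomp Require Import all_classical all_reals all_analysis.
From mathcomp Require Import complex.
From mathcomp Require Import perm ring lra zify.

Import Order.TTheory GRing.Theory Num.Theory.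

Local Open Scope ring_scope.

(** * The real-valued complex modulus *)

Section Modulus.
Context {R : realType}.
Implicit Types z w : R[i].

Lemma cabs_ge0 z : 0 <= cabs z.
Proof. by case: z => x y; rewrite /cabs /= sqrtr_ge0. Qed.

Lemma cabs0 : cabs (0 : R[i]) = 0.
Proof. exact: Normc.normc0. Qed.

Lemma cabsM z w : cabs (z * w) = cabs z * cabs w.
Proof. exact: Normc.normcM. Qed.

Lemma cabsN z : cabs (- z) = cabs z.
Proof. exact: normcN. Qed.

Lemma cabsD z w : cabs (z + w) <= cabs z + cabs w.
Proof. exact: le_normcD. Qed.

Lemma cabs_real (x : R) : cabs x%:C%C = `|x|.
Proof. by rewrite /cabs /= expr0n /= addr0 sqrtr_sqr. Qed.

Lemma cabs_sum (I : Type) (r : seq I) (P : pred I) (F : I -> R[i]) :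
  cabs (\sum_(i <- r | P i) F i) <= \sum_(i <- r | P i) cabs (F i).
Proof.
elim/big_ind2: _ => [|x y z t Hx Hy|//]; first by rewrite cabs0.
exact: le_trans (cabsD _ _) (lerD Hx Hy).
Qed.

Lemma cabs_sqr z : (cabs z ^+ 2)%:C%C = z * z^*%C.
Proof.
case: z => x y; rewrite /cabs /= sqr_sqrtr ?addr_ge0 ?sqr_ge0 //.
by apply/eqP; rewrite eq_complex /=; apply/andP; split; apply/eqP; ring.
Qed.

End Modulus.

(** * Random samples and dominant points in a finite-dimensional function space *)

Section Sampling.
Context {R : realType} {X I : finType} (u : X -> R) (phi : I -> X -> R[i]).

(* The points [w l] are dependent for [phi], and the coefficient of [w i] in some
   dependency is maximal in modulus. *)
Definition dominant (w : {ffun 'I_#|I|.+1 -> X}) (i : 'I_#|I|.+1) : Prop :=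
  exists c : 'I_#|I|.+1 -> R[i],
    [/\ c i = 1, forall l, cabs (c l) <= 1
      & forall r, \sum_l c l * phi r (w l) = 0].

(** There are [#|I| + 1] rows in a space of dimension [#|I|], so the left kernel is nonzero; divide
    a kernel vector by its entry of largest modulus. *)
Lemma exists_dominant w : exists i, dominant w i.
Proof.
pose A : 'M[R[i]]_(#|I|.+1, #|I|) := \matrix_(l, r) phi (enum_val r) (w l).
have : kermx A != 0.
  rewrite kermx_eq0 -row_leq_rank -ltnNge ltnS.
  exact: rank_leq_col.
rewrite -nz_row_eq0 => nz.
set v := nz_row (kermx A) in nz.
have vA : v *m A = 0 by apply/sub_kermxP; exact: nz_row_sub.
have [i _ imax] := arg_maxP (fun l => cabs (v 0 l)) (erefl true : xpredT (ord0 : 'I_#|I|.+1)).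
have vi0 : v 0 i != 0.
  apply: contra nz => /eqP vi0; apply/eqP/rowP => l; rewrite mxE.
  have := imax l isT; rewrite vi0 cabs0 => le0.
  apply: Normc.eq0_normc; apply/eqP; rewrite eq_le cabs_ge0 andbT.
  exact: le0.
exists i, (fun l => v 0 l / v 0 i); split=> [|l|r].
- by rewrite divff.
- have ci : 0 < cabs (v 0 i).
    rewrite lt_neqAle cabs_ge0 andbT eq_sym; apply: contra vi0 => /eqP h.
    by apply/eqP/Normc.eq0_normc.
  rewrite cabsM [cabs _^-1]Normc.normcV ler_pdivrMr ?mul1r //.
  exact: imax.
- have /rowP /(_ (enum_rank r)) := vA; rewrite !mxE => h.
  transitivity ((\sum_j v 0 j * A j (enum_rank r)) / v 0 i); last by rewrite h mul0r.
  rewrite mulr_suml; apply: eq_bigr => l _.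
  by rewrite mxE enum_rankK mulrAC.
Qed.

Lemma sum_prod_fixed0 (n : nat) (h : 'I_n.+1 -> X -> R) (y : X) :
  \sum_(w : {ffun 'I_n.+1 -> X} | w ord0 == y) \prod_(i | i != ord0) h i (w i) =
  \prod_(i | i != ord0) \sum_x h i x.
Proof.
(* The constraint at [ord0] becomes an indicator factor, so the sum over functions factorises. *)
pose F (i : 'I_n.+1) x := if i == ord0 then (x == y)%:R else h i x.
have F0 : \sum_x F ord0 x = 1.
  rewrite (bigD1 y) //= {1}/F !eqxx big1 ?addr0 // => x /negbTE xy.
  by rewrite /F eqxx xy.
transitivity (\prod_i \sum_x F i x); last first.
  rewrite (bigD1 ord0) //= F0 mul1r; apply: eq_bigr => i /negbTE i0.
  by apply: eq_bigr => x _; rewrite /F i0.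
rewrite bigA_distr_bigA big_mkcond; apply: eq_bigr => w _.
rewrite [RHS](bigD1 ord0) //= {1}/F eqxx; case: eqP => _; last by rewrite mul0r.
by rewrite mul1r; apply: eq_bigr => i /negbTE i0; rewrite /F i0.
Qed.

Lemma sum_prod_fixed0_const (n : nat) (y : X) :
  \sum_(w : {ffun 'I_n.+1 -> X} | w ord0 == y) \prod_(i | i != ord0) u (w i) =
  (\sum_x u x) ^+ n.
Proof.
rewrite (@sum_prod_fixed0 n (fun=> u)) prodr_const; congr (_ ^+ _).
by rewrite cardC1 card_ord.
Qed.

Hypothesis u_ge0 : forall x, 0 <= u x.
Hypothesis u_gt0 : 0 < \sum_x u x.

(** Swapping the coordinates [i] and [ord0] preserves the product weight and exchanges the two
    dominance conditions. *)
Lemma sum_dominant (i : 'I_#|I|.+1) :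
  \sum_(w : {ffun 'I_#|I|.+1 -> X} | `[< dominant w i >]) \prod_l u (w l) =
  \sum_(w : {ffun 'I_#|I|.+1 -> X} | `[< dominant w ord0 >]) \prod_l u (w l).
Proof.
pose s := tperm i ord0.
pose T (w : {ffun 'I_#|I|.+1 -> X}) := [ffun l => w (s l)].
have TK : involutive T by move=> w; apply/ffunP => l; rewrite !ffunE tpermK.
have dT w j : dominant w j -> dominant (T w) (s j).
  move=> [c [cj c1 c0]]; exists (fun l => c (s l)); split=> [|l|r].
  - by rewrite tpermK.
  - exact: c1.
  - rewrite (reindex_inj (@perm_inj _ s)) /= -[RHS](c0 r); apply: eq_bigr => l _.
    by rewrite ffunE !tpermK.
rewrite (reindex_inj (inv_inj TK)); apply: eq_big => [w|w _].
  apply/asboolP/asboolP => /dT; last by rewrite tpermR.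
  by rewrite TK tpermL.
rewrite (reindex_inj (@perm_inj _ s)) /=; apply: eq_bigr => l _.
by rewrite ffunE tpermK.
Qed.

(* [p y] is the probability that [y] is the dominant point of a random sample
   consisting of [y] and of [#|I|] independent points drawn according to [u]. *)
Lemma sampling : exists p : X -> R,
  [/\ forall y, 0 <= p y <= 1,
      (\sum_x u x) / #|I|.+1%:R <= \sum_y u y * p y
    & forall (G : X -> R[i]) (b : I -> R[i]),
      (forall x, G x = \sum_r b r * phi r x) -> forall y,
      p y * cabs (G y) <= #|I|%:R / (\sum_x u x) * \sum_x u x * cabs (G x)].
Proof.
set Q := #|I|; set U := \sum_x u x.
have U_gt0 : 0 < U by [].
have UQ : 0 < U ^+ Q by rewrite exprn_gt0.
pose W := {ffun 'I_Q.+1 -> X}.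
pose S y := \sum_(w : W | (w ord0 == y) && `[< dominant w ord0 >])
               \prod_(i | i != ord0) u (w i).
have S_ge0 y : 0 <= S y by apply: sumr_ge0 => w _; apply: prodr_ge0.
exists (fun y => S y / U ^+ Q); split=> [y||G b Gb y].
- rewrite divr_ge0 ?S_ge0 ?(ltW UQ) //= ler_pdivrMr // mul1r.
  rewrite -(sum_prod_fixed0_const Q y) [leRHS](bigID (fun w => `[< dominant w ord0 >])) /=.
  by rewrite lerDl; apply: sumr_ge0 => w _; apply: prodr_ge0.
- have -> : \sum_y u y * (S y / U ^+ Q) =
     (\sum_(w : W | `[< dominant w ord0 >]) \prod_l u (w l)) / U ^+ Q.
    under eq_bigr do rewrite mulrA; rewrite -mulr_suml; congr (_ / _).
    rewrite (partition_big (fun w : W => w ord0) xpredT) //=.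
    apply: eq_bigr => y _; rewrite mulr_sumr.
    apply: eq_big => [w|w /andP[/eqP wy _]]; first by rewrite andbC.
    by rewrite [in RHS](bigD1 ord0) //= wy.
  (* By symmetry, [Q + 1] times this weight is the sum over all indices [i]. Every sample has a
     dominant index, so that sum is at least the full weight [U ^ Q.+1]. *)
  rewrite ler_pdivlMr // mulrAC -exprS ler_pdivrMr ?ltr0n // mulr_natr.
  rewrite -[X in _ *+ X]card_ord -sumr_const.
  rewrite -(eq_bigr _ (fun i _ => sum_dominant i)).
  under eq_bigr do rewrite big_mkcond.
  rewrite exchange_big /=.
  have -> : U ^+ Q.+1 = \sum_(w : W) \prod_l u (w l).
    by rewrite -(bigA_distr_bigA (fun _ => u)) prodr_const card_ord.
  apply: ler_sum => w _; have [i di] := exists_dominant w.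
  rewrite [leRHS](bigD1 i) //= asboolT // lerDl; apply: sumr_ge0 => l _.
  by case: ifP => // _; apply: prodr_ge0.
- rewrite mulrAC ler_pdivrMr // mulr_suml.
  (* Since [G] is in the span of [phi], the dependency of the sample also annihilates [G]; solve it
     for the value at [ord0]. *)
  have Gdom (w : W) : dominant w ord0 ->
      cabs (G (w ord0)) <= \sum_(l | l != ord0) cabs (G (w l)).
    move=> [c [c0 c1 cphi]].
    have : \sum_l c l * G (w l) = 0.
      rewrite (eq_bigr (fun l => \sum_r b r * (c l * phi r (w l)))); last first.
        by move=> l _; rewrite Gb mulr_sumr; apply: eq_bigr => r _; rewrite mulrCA.
      by rewrite exchange_big big1 // => r _; rewrite -mulr_sumr cphi mulr0.
    rewrite (bigD1 ord0) //= c0 mul1r => /eqP; rewrite addr_eq0 => /eqP ->.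
    rewrite cabsN; apply: le_trans (cabs_sum _ _ _ _) _; apply: ler_sum => l _.
    by rewrite cabsM ler_piMl ?cabs_ge0.
  apply: (@le_trans _ _ (\sum_(w : W | w ord0 == y)
      \sum_(l | l != ord0) \prod_(i | i != ord0) u (w i) * cabs (G (w l)))).
    rewrite [leRHS](bigID (fun w => `[< dominant w ord0 >])) /=.
    rewrite -[leLHS]addr0; apply: lerD; last first.
      apply: sumr_ge0 => w _; apply: sumr_ge0 => l _.
      by rewrite mulr_ge0 ?cabs_ge0 ?prodr_ge0.
    apply: ler_sum => w /andP[/eqP <- /asboolP dw].
    by rewrite -mulr_sumr ler_wpM2l ?Gdom ?prodr_ge0.
  rewrite exchange_big /=.
  rewrite (eq_bigr (fun=> U ^+ Q.-1 * \sum_x u x * cabs (G x))); last first.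
    move=> l l0.
    (* Coordinate [l] yields the weighted sum of [cabs (G x)]; each of the other [Q - 1] free
       coordinates yields [U]. *)
    pose h i x := u x * (if i == l then cabs (G x) else 1).
    transitivity (\sum_(w : W | w ord0 == y) \prod_(i | i != ord0) h i (w i)).
      apply: eq_bigr => w _; rewrite big_split /= -big_mkcondr; congr (_ * _).
      rewrite (bigD1 l) ?eqxx ?l0 //= big1 ?mulr1 // => i.
      by case/andP => /andP[_ /eqP ->]; rewrite eqxx.
    rewrite sum_prod_fixed0 (bigD1 l) //= mulrC; congr (_ * _); last first.
      by apply: eq_bigr => x _; rewrite /h eqxx.
    rewrite (eq_bigr (fun=> U)); last first.
      move=> i /andP[_ /negbTE il]; rewrite /h il.
      by apply: eq_bigr => x _; rewrite mulr1.
    rewrite prodr_const; congr (_ ^+ _).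
    have lC : l \in predC1 (ord0 : 'I_Q.+1) by rewrite inE.
    have := cardD1 l (predC1 (ord0 : 'I_Q.+1)).
    rewrite cardC1 card_ord lC => /(congr1 predn) /= ->; apply: eq_card => i.
    by rewrite !inE andbC.
  rewrite sumr_const cardC1 card_ord /=.
  (* The truncated predecessor [Q.-1] is harmless at [Q = 0], where there is no [l] to sum over. *)
  case: {+}Q => [|q]; first by rewrite mulr0n !mul0r.
  rewrite exprS /=; set Z := \sum_x _; rewrite -[_ *+ _]mulr_natl le_eqVlt.
  by apply/orP; left; apply/eqP; field; rewrite lt0r_neq0.
Qed.

End Sampling.

(** * Additive characters and Fourier analysis on Z/NZ *)

Section Characters.
Context {R : realType} {N : nat}.
Hypothesis N_gt1 : (1 < N)%N.
Implicit Types (s t x y : 'Z_N) (f : 'Z_N -> R).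

(** The basic additive character; frequency [r] corresponds to [x |-> chi (r * x)]. *)
Definition chi (t : 'Z_N) : R[i] := omega R N ^+ t.

Lemma omegaX j : omega R N ^+ j =
  (cos (2 * pi / N%:R * j%:R) +i* sin (2 * pi / N%:R * j%:R))%C.
Proof.
elim: j => [|j IH]; first by rewrite expr0 mulr0 cos0 sin0.
rewrite exprSr IH /omega -[j.+1%:R]natr1 (mulrDr _ j%:R) mulr1 cosD sinD.
by apply/eqP; rewrite eq_complex /=; apply/andP; split; apply/eqP; ring.
Qed.

Let N_neq0 : N%:R != 0 :> R.
Proof. by rewrite pnatr_eq0 -lt0n ltnW. Qed.

Lemma omega_order : omega R N ^+ N = 1.
Proof.
rewrite omegaX divfK // mulr_natl; apply/eqP.
by rewrite eq_complex /= -[pi *+ 2]add0r cosD2pi sinD2pi cos0 sin0 !eqxx.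
Qed.

(** The real part is [cos (2 a) = 1 - 2 sin(a)^2] with [a = pi j / N] strictly between [0] and [pi],
    so it is not [1]. *)
Lemma omega_neq1 j : (0 < j < N)%N -> omega R N ^+ j != 1.
Proof.
case/andP=> j0 jN; rewrite omegaX eq_complex /= negb_and; apply/orP; left.
have NR : 0 < N%:R :> R by rewrite ltr0n ltnW.
have -> : 2 * pi / N%:R * j%:R = (pi * (j%:R / N%:R)) *+ 2 :> R by field.
have : 0 < sin (pi * (j%:R / N%:R) : R).
  apply: sin_gt0_pi; apply/andP; split.
    by rewrite mulr_gt0 ?pi_gt0 ?divr_gt0 ?NR ?ltr0n.
  by rewrite gtr_pMr ?pi_gt0 // ltr_pdivrMr // mul1r ltr_nat.
set a := pi * _ => sa; rewrite cos_mulr2n cos2sin2; apply/eqP => h.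
suff : sin a ^+ 2 = 0 by apply/eqP; rewrite sqrf_eq0 gt_eqF.
by move: h; rewrite mulr2n; lra.
Qed.

Lemma chiE (j : nat) : chi j%:R = omega R N ^+ j.
Proof. by rewrite /chi val_Zp_nat // expr_mod ?omega_order. Qed.

Lemma chiM s t : omega R N ^+ (s * t)%N = chi (s * t).
Proof. by rewrite -chiE natrM !natr_Zp. Qed.

Lemma chi0 : chi 0 = 1.
Proof. by rewrite /chi expr0. Qed.

Lemma chiD s t : chi (s + t) = chi s * chi t.
Proof. by rewrite -[s]natr_Zp -[t]natr_Zp -natrD !chiE exprD. Qed.

Lemma cabs_chi t : cabs (chi t) = 1.
Proof.
rewrite /chi omegaX /cabs /= cos2Dsin2.
exact: sqrtr1.
Qed.

Lemma conj_chi t : (chi t)^*%C = chi (- t).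
Proof.
have nz : chi t != 0.
  by apply/eqP => h; have := cabs_chi t; rewrite h cabs0 => /esym/eqP; rewrite oner_eq0.
by apply: (mulfI nz); rewrite -chiD subrr chi0 -cabs_sqr cabs_chi expr1n.
Qed.

Lemma card_Zp_N : #|{: 'Z_N}| = N.
Proof. by rewrite card_ord Zp_cast. Qed.

Lemma sum_chi t : \sum_x chi (t * x) = if t == 0 then N%:R else 0.
Proof.
case: eqP => [->|/eqP t0].
  rewrite (eq_bigr (fun=> 1)) => [|x _]; last by rewrite mul0r chi0.
  by rewrite sumr_const card_Zp_N.
have : chi t != 1.
  apply: omega_neq1; rewrite lt0n; apply/andP; split; first exact: t0.
  by rewrite -[X in (_ < X)%N](Zp_cast N_gt1) ltn_ord.
(* Translating [x] by [1] multiplies the sum by [chi t], which differs from [1]. *)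
rewrite -subr_eq0 => ct; apply: (mulfI ct); rewrite mulr0 mulrBl mul1r.
apply/eqP; rewrite subr_eq0; apply/eqP.
rewrite mulr_sumr [RHS](reindex_inj (addIr 1)) /=; apply: eq_bigr => x _.
by rewrite mulrDr mulr1 addrC chiD.
Qed.

(** Orthogonality of characters kills the off-diagonal terms. Arbitrary coefficients [c] are allowed
    so that this serves both for [fourier f] and for the truncation error. *)
Lemma parseval (c : 'Z_N -> R[i]) :
  \sum_x cabs (\sum_r c r * chi (r * x)) ^+ 2 = N%:R * \sum_r cabs (c r) ^+ 2.
Proof.
apply: complexI; rewrite rmorph_sum rmorphM rmorph_sum rmorph_nat /=.
transitivity (\sum_x \sum_r \sum_s c r * (c s)^*%C * chi ((r - s) * x)).
  apply: eq_bigr => x _; rewrite cabs_sqr rmorph_sum /= mulr_suml.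
  apply: eq_bigr => r _; rewrite mulr_sumr; apply: eq_bigr => s _.
  by rewrite rmorphM /= conj_chi mulrBl chiD; ring.
rewrite exchange_big mulr_sumr; apply: eq_bigr => r _ /=.
rewrite exchange_big (bigD1 r) //= [X in _ + X]big1 => [|s rs]; last first.
  by rewrite -mulr_sumr sum_chi subr_eq0 eq_sym (negbTE rs) mulr0.
by rewrite -mulr_sumr sum_chi subrr eqxx addr0 cabs_sqr mulrC.
Qed.

Lemma fourierE f t : fourier f t = \sum_x (f x)%:C%C * chi (x * t).
Proof. by apply: eq_bigr => x _; rewrite chiM mulrC [x * t]mulrC mulrC. Qed.

Lemma fourier_parseval f :
  \sum_t cabs (fourier f t) ^+ 2 = N%:R * \sum_x f x ^+ 2.
Proof.
under eq_bigr do rewrite fourierE.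
rewrite parseval; congr (_ * _); apply: eq_bigr => x _.
by rewrite cabs_real real_normK ?num_real.
Qed.

Lemma fourier_inversion f x :
  \sum_t fourier f t * chi (t * - x) = N%:R * (f x)%:C%C.
Proof.
transitivity (\sum_t \sum_y (f y)%:C%C * chi ((y - x) * t)).
  apply: eq_bigr => t _; rewrite fourierE mulr_suml; apply: eq_bigr => y _.
  by rewrite -mulrA -chiD; congr (_ * chi _); ring.
rewrite exchange_big (bigD1 x) //= [X in _ + X]big1 => [|y yx]; last first.
  by rewrite -mulr_sumr sum_chi subr_eq0 (negbTE yx) mulr0.
by rewrite -mulr_sumr sum_chi subrr eqxx addr0 mulrC.
Qed.

End Characters.

(** * Weighted sums over the values of a linear form *)

Section LinearFormSums.
Context {R : realType} {N : nat}.
Implicit Types (u G H p : 'Z_N -> R) (v w y : 'Z_N).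

(** The shift [v] carries the variables already fixed, which lets variables be split off one at a
    time. *)
Definition form_sum {n} (a : 'I_n -> 'Z_N) u G v : R :=
  \sum_(x : {ffun 'I_n -> 'Z_N}) (\prod_i u (x i)) * G (v + \sum_i a i * x i).

Lemma form_sum0 (a : 'I_0 -> 'Z_N) u G v : form_sum a u G v = G v.
Proof.
rewrite /form_sum (eq_bigr (fun=> G v)) => [|x _]; last first.
  by rewrite !big_ord0 mul1r addr0.
by rewrite sumr_const card_ffun [#|'I_0|]card_ord mulr1n.
Qed.

Lemma form_sumS n (a : 'I_n.+1 -> 'Z_N) u G v :
  form_sum a u G v =
  \sum_t u t * form_sum (fun i => a (lift ord0 i)) u G (v + a ord0 * t).
Proof.
pose cons (q : 'Z_N * {ffun 'I_n -> 'Z_N}) : {ffun 'I_n.+1 -> 'Z_N} :=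
  [ffun i => oapp q.2 q.1 (unlift ord0 i)].
pose uncons (x : {ffun 'I_n.+1 -> 'Z_N}) := (x ord0, [ffun i => x (lift ord0 i)]).
have consK : cancel cons uncons.
  move=> [t x]; rewrite /uncons /cons; congr (_, _); first by rewrite ffunE unlift_none.
  by apply/ffunP => i; rewrite !ffunE liftK.
have unconsK : cancel uncons cons.
  move=> x; apply/ffunP => i; rewrite ffunE.
  by case: unliftP => [j ->|->] //=; rewrite ffunE.
rewrite /form_sum (reindex cons) /=; last by exists uncons => x _.
under [RHS]eq_bigr do rewrite mulr_sumr.
rewrite pair_big /=; apply: eq_bigr => -[t x] _ /=.
rewrite !big_ord_recl !ffunE unlift_none /= mulrA; congr (_ * _ * G _).
  by apply: eq_bigr => i _; rewrite ffunE liftK.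
rewrite addrA; congr (_ + _).
by apply: eq_bigr => i _; rewrite ffunE liftK.
Qed.

(** Here the first variable is summed innermost, whereas [form_sumS] sums it outermost. *)
Lemma form_sum_recl n (a : 'I_n.+1 -> 'Z_N) u G v :
  form_sum a u G v =
  form_sum (fun i => a (lift ord0 i)) u (fun w => \sum_t u t * G (w + a ord0 * t)) v.
Proof.
rewrite form_sumS [RHS]/form_sum.
under [RHS]eq_bigr do rewrite mulr_sumr.
rewrite exchange_big; apply: eq_bigr => t _.
rewrite mulr_sumr; apply: eq_bigr => x _.
by rewrite mulrCA; congr (_ * (_ * G _)); ring.
Qed.

Lemma form_sum_const n (a : 'I_n -> 'Z_N) u c v :
  form_sum a u (fun=> c) v = (\sum_x u x) ^+ n * c.
Proof.
rewrite /form_sum -mulr_suml; congr (_ * _).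
by rewrite -(bigA_distr_bigA (fun=> u)) prodr_const card_ord.
Qed.

Lemma form_sumD n (a : 'I_n -> 'Z_N) u G H v :
  form_sum a u (fun w => G w + H w) v = form_sum a u G v + form_sum a u H v.
Proof. by rewrite /form_sum -big_split; apply: eq_bigr => x _; rewrite mulrDr. Qed.

Lemma ler_form_sum n (a : 'I_n -> 'Z_N) u G H v :
  (forall x, 0 <= u x) -> (forall w, G w <= H w) ->
  form_sum a u G v <= form_sum a u H v.
Proof.
by move=> u0 GH; apply: ler_sum => x _; rewrite ler_wpM2l ?prodr_ge0.
Qed.

Lemma ler_form_sum_weight n (a : 'I_n -> 'Z_N) u u' G v :
  (forall x, 0 <= u x <= u' x) -> (forall w, 0 <= G w) ->
  form_sum a u G v <= form_sum a u' G v.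
Proof.
move=> uu G0; apply: ler_sum => x _; apply: ler_wpM2r => //.
exact: ler_prod.
Qed.

(** Start with all [n] variables equal to [y] and free them one by one. Each use of the hypothesis,
    with the remaining variables absorbed into the shift, spends one factor [p y] and costs one
    factor [K]. *)
Lemma iterate_domination n (b : 'I_n -> 'Z_N) u G p (K : R) v y :
  (forall x, 0 <= u x) -> (forall x, 0 <= p x) -> 0 <= K ->
  (forall i v, p y * G (v + b i * y) <= K * \sum_x u x * G (v + b i * x)) ->
  p y ^+ n * G (v + (\sum_i b i) * y) <= K ^+ n * form_sum b u G v.
Proof.
move=> u0 p0 K0; elim: n b v => [|n IH] b v dom.
  by rewrite form_sum0 big_ord0 mul0r addr0 !expr0.
rewrite form_sumS big_ord_recl; set S := \sum_i _.
have -> : v + (b ord0 + S) * y = v + S * y + b ord0 * y by ring.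
rewrite exprSr -mulrA.
apply: (le_trans (ler_wpM2l (exprn_ge0 _ (p0 y)) (dom _ _))).
rewrite mulrCA exprS -mulrA ler_wpM2l // !mulr_sumr; apply: ler_sum => x _.
rewrite mulrCA [leRHS]mulrCA ler_wpM2l // addrAC.
by apply: IH => i w; exact: dom.
Qed.

End LinearFormSums.

(** * Convexity of powers and the Cauchy-Schwarz inequality *)

Section PowerMean.
Context {R : realFieldType}.

(** The graph of the power lies above its tangent at [q]; in the induction the gap grows by a
    multiple of [(p - q) ^ 2]. *)
Lemma exprn_tangent (p q : R) n : 0 <= p -> 0 <= q ->
  q ^+ n.+1 + n.+1%:R * q ^+ n * (p - q) <= p ^+ n.+1.
Proof.
move=> p0 q0; elim: n => [|n IH]; first by rewrite expr0 !expr1; lra.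
rewrite [leRHS]exprS; apply: le_trans (ler_wpM2l p0 IH).
rewrite -subr_ge0.
have -> : p * (q ^+ n.+1 + n.+1%:R * q ^+ n * (p - q)) -
   (q ^+ n.+2 + n.+2%:R * q ^+ n.+1 * (p - q)) = n.+1%:R * q ^+ n * (p - q) ^+ 2.
  by rewrite -[n.+2%:R]natr1 !exprS; ring.
exact: (mulr_ge0 (mulr_ge0 (ler0n _ _) (exprn_ge0 _ q0)) (sqr_ge0 _)).
Qed.

(** Average the tangent inequality at [q] with weights [u]: the hypothesis makes the linear term
    nonnegative. *)
Lemma power_mean (X : finType) (u p : X -> R) (q : R) n :
  (forall x, 0 <= u x) -> (forall x, 0 <= p x) -> 0 <= q ->
  (\sum_x u x) * q <= \sum_x u x * p x ->
  (\sum_x u x) * q ^+ n <= \sum_x u x * p x ^+ n.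
Proof.
move=> u0 p0 q0 h; case: n => [|n].
  by rewrite expr0 mulr1; under [leRHS]eq_bigr do rewrite expr0 mulr1.
apply: (@le_trans _ _ (\sum_x u x * (q ^+ n.+1 + n.+1%:R * q ^+ n * (p x - q)))).
  have -> : \sum_x u x * (q ^+ n.+1 + n.+1%:R * q ^+ n * (p x - q)) =
    (\sum_x u x) * q ^+ n.+1 +
      n.+1%:R * q ^+ n * (\sum_x u x * p x - (\sum_x u x) * q).
    rewrite !mulr_suml -sumrB mulr_sumr -big_split; apply: eq_bigr => x _ /=.
    by ring.
  by rewrite lerDl !mulr_ge0 ?ler0n ?exprn_ge0 ?subr_ge0.
by apply: ler_sum => x _; rewrite ler_wpM2l ?exprn_tangent.
Qed.

Lemma sum_mul_le_sqrt (X : finType) (u v : X -> R) (c d : R) :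
  0 <= c -> 0 <= d -> \sum_x u x ^+ 2 <= c ^+ 2 -> \sum_x v x ^+ 2 <= d ^+ 2 ->
  \sum_x u x * v x <= c * d.
Proof.
move=> c0 d0 uc vd.
(* A weighted arithmetic-geometric mean inequality, which divides by [s] and [t]; as [c] or [d] may
   vanish, the bound is proved for larger positive numbers and then passed to the limit. *)
have key s t : 0 < s -> 0 < t -> c <= s -> d <= t -> \sum_x u x * v x <= s * t.
  move=> s0 t0 cs dt.
  have sn : s != 0 by rewrite gt_eqF.
  have tn : t != 0 by rewrite gt_eqF.
  apply: (@le_trans _ _ (\sum_x (t / (2 * s) * u x ^+ 2 + s / (2 * t) * v x ^+ 2))).
    apply: ler_sum => x _; rewrite -subr_ge0.
    have -> : t / (2 * s) * u x ^+ 2 + s / (2 * t) * v x ^+ 2 - u x * v x =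
       (2 * s * t)^-1 * (t * u x - s * v x) ^+ 2 by field; rewrite sn tn.
    by rewrite mulr_ge0 ?sqr_ge0 // invr_ge0 !mulr_ge0 // ltW.
  rewrite big_split /= -!mulr_sumr.
  apply: (@le_trans _ _ (t / (2 * s) * s ^+ 2 + s / (2 * t) * t ^+ 2)).
    apply: lerD; apply: ler_wpM2l.
    - by rewrite divr_ge0 ?mulr_ge0 // ltW.
    - by apply: (le_trans uc); rewrite lerXn2r // nnegrE ?(ltW s0).
    - by rewrite divr_ge0 ?mulr_ge0 // ltW.
    - by apply: (le_trans vd); rewrite lerXn2r // nnegrE ?(ltW t0).
  by rewrite le_eqVlt; apply/orP; left; apply/eqP; field; rewrite sn tn.
apply/ler_addgt0Pr => e e0.
pose r := Num.min 1 (e / (c + d + 1)).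
have cd : 0 < c + d + 1 by lra.
have r0 : 0 < r by rewrite lt_min ltr01 divr_gt0.
have r1 : r <= 1 by rewrite ge_min lexx.
have re : r * (c + d + 1) <= e by rewrite -ler_pdivlMr // ge_min lexx orbT.
apply: (le_trans (key (c + r) (d + r) _ _ _ _)); nra.
Qed.

End PowerMean.

(** * Lower bound for the weighted number of solutions *)

Section Counting.
Context {R : realType} {N m : nat}.
Hypothesis N_gt1 : (1 < N)%N.
Variable a : 'I_m.+2 -> 'Z_N.
Let b (i : 'I_m.+1) : 'Z_N := a (lift ord0 i).
Hypothesis sum_a : \sum_i a i = 0.
Hypothesis a0_unit : a ord0 \is a GRing.unit.
Hypothesis b0_unit : b ord0 \is a GRing.unit.
Implicit Types (f u : 'Z_N -> R) (v w y : 'Z_N).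

Lemma sum_solutions f :
  \sum_(x : {ffun 'I_m.+2 -> 'Z_N} | \sum_i a i * x i == 0) \prod_i f (x i) =
  form_sum b f (fun w => f (- w / a ord0)) 0.
Proof.
transitivity (form_sum a f (fun w => (w == 0)%:R) 0).
  rewrite big_mkcond; apply: eq_bigr => x _; rewrite add0r.
  by case: eqP => _; rewrite ?mulr1 ?mulr0.
rewrite form_sum_recl; apply: eq_bigr => x _; congr (_ * _).
set w := 0 + _.
have wE t : (w + a ord0 * t == 0) = (t == - w / a ord0).
  rewrite -(inj_eq (mulrI a0_unit) t) mulrCA divrr // mulr1.
  by rewrite addrC addr_eq0.
rewrite (bigD1 (- w / a ord0)) //= wE eqxx mulr1 big1 ?addr0 // => t.
by rewrite wE => /negbTE ->; rewrite mulr0.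
Qed.

(** Both coefficients are units, so [y |-> - (w + b ord0 * y) / a ord0] is a bijection; this
    transfers the L^2 bound on the error to [x_1] as a function of [x_2]. *)
Lemma sum_affine (F : 'Z_N -> R) w :
  \sum_y F (- (w + b ord0 * y) / a ord0) = \sum_y F y.
Proof.
apply/esym/(@reindex_inj _ _ _ _ (fun y => - (w + b ord0 * y) / a ord0)) => y y' /=.
have aV : (a ord0)^-1 \is a GRing.unit by rewrite unitrV.
by move/(mulIr aV)/oppr_inj/addrI/(mulrI b0_unit).
Qed.

(** Here [tau] bounds [f] from below where [u] is positive, [V] and [E] are L^2 bounds for [u] and
    for [f - g], and [D] dominates the sample size. The conclusion is [main] below, multiplied by
    [(U / D) ^ m]. *)
Lemma solutions_lower_bound (K : nat) (s : 'I_K -> 'Z_N) (c : 'I_K -> R[i]) f u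
    (g := fun x => \sum_i c i * chi (s i * x)) (tau V E D : R) :
  (forall x, 0 <= u x <= f x) -> 0 < \sum_x u x ->
  0 <= tau -> (forall x, tau * u x <= u x * f x) ->
  0 <= V -> \sum_x u x ^+ 2 <= V ^+ 2 ->
  0 <= E -> \sum_x cabs ((f x)%:C%C - g x) ^+ 2 <= E ^+ 2 ->
  (K * m).+1%:R <= D ->
  ((\sum_x u x) / D) ^+ m *
    (tau * (\sum_x u x) * D ^- m - V * E * (1 + D ^+ m)) <=
  \sum_(x : {ffun 'I_m.+2 -> 'Z_N} | \sum_i a i * x i == 0) \prod_i f (x i).
Proof.
move=> uf U0 tau0 ftau V0 uV E0 eE KD.
set U := \sum_x u x in U0 *; rewrite sum_solutions; set T := form_sum _ _ _ _.
have u0 x : 0 <= u x by case/andP: (uf x).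
have f0 x : 0 <= f x by case/andP: (uf x) => /le_trans h /h.
have D0 : 0 < D by apply: lt_le_trans KD; rewrite ltr0Sn.
pose e x := cabs ((f x)%:C%C - g x).
(* One character for each term of [g] and each variable to be freed, so a single [p] serves for all
   the variables. *)
pose phi (r : 'I_K * 'I_m) x : R[i] :=
  chi (- (s r.1 * (b (lift ord0 r.2) * x / a ord0))).
have [p [p01 pavg pdom]] := sampling u phi u0 U0.
have p0 x : 0 <= p x by case/andP: (p01 x).
have p1 x : p x <= 1 by case/andP: (p01 x).
have cI : #|{: 'I_K * 'I_m}| = (K * m)%N by rewrite card_prod !card_ord.
rewrite cI in pavg pdom.
set k := (K * m)%:R / U in pdom.
have k0 : 0 <= k by rewrite divr_ge0 ?ler0n ?ltW.
have kD : k <= D / U.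
  rewrite ler_pM2r ?invr_gt0 //; apply: le_trans KD.
  by rewrite ler_nat leqnSn.
pose G w := cabs (g (- w / a ord0)).
have G0 w : 0 <= G w by exact: cabs_ge0.
(* The shift [v] only changes the coefficients of the characters, not their span. *)
have dom i v y : p y * G (v + b (lift ord0 i) * y) <=
    k * \sum_x u x * G (v + b (lift ord0 i) * x).
  apply: (pdom (fun x => g (- (v + b (lift ord0 i) * x) / a ord0))
    (fun r => if r.2 == i then c r.1 * chi (- (s r.1 * (v / a ord0))) else 0)).
  move=> x; rewrite /g.
  transitivity (\sum_j \sum_l
    (if l == i then c j * chi (- (s j * (v / a ord0))) else 0) * phi (j, l) x);
    last by rewrite pair_bigA.
  apply: eq_bigr => j _; rewrite (bigD1 i) //= eqxx big1 ?addr0 => [|l /negbTE ->].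
    by rewrite /phi -[RHS]mulrA -chiD //=; congr (_ * chi _); ring.
  by rewrite mul0r.
have step y : p y ^+ m * cabs (g y) <=
    k ^+ m * form_sum (fun i => b (lift ord0 i)) u G (b ord0 * y).
  have := iterate_domination _ (fun i : 'I_m => b (lift ord0 i)) u G p k (b ord0 * y) y
    u0 p0 k0 (fun i v => dom i v y).
  (* The trivial solution: the coefficients sum to zero, so [x_2 = .. = x_d = y] gives [x_1 = y]. *)
  have -> : b ord0 * y + (\sum_i b (lift ord0 i)) * y = - (a ord0 * y).
    rewrite -mulrDl -mulNr; congr (_ * _); apply/eqP.
    by rewrite -addr_eq0 addrC -[X in _ == X]sum_a !big_ord_recl.
  by rewrite /G opprK mulrAC divrr // mul1r.
have VE w : \sum_y u y * e (- (w + b ord0 * y) / a ord0) <= V * E.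
  by apply: sum_mul_le_sqrt => //; rewrite (sum_affine (fun z => e z ^+ 2)).
have VE' : \sum_y u y * e y <= V * E by exact: sum_mul_le_sqrt.
(* Use [|g| <= f + e]. Summing over [x_2] first bounds the [e] part by [V * E]; the other [m]
   variables contribute [U ^ m]. *)
have GT : form_sum b u G 0 <= T + U ^+ m * (V * E).
  apply: (@le_trans _ _ (form_sum b u
      (fun w => f (- w / a ord0) + e (- w / a ord0)) 0)).
    apply: ler_form_sum => // w; rewrite /G /e; set z := - w / _.
    rewrite -[X in cabs X <= _](subKr (f z)%:C%C).
    by apply: le_trans (cabsD _ _) _; rewrite cabsN cabs_real ger0_norm.
  rewrite form_sumD; apply: lerD; first exact: ler_form_sum_weight.
  rewrite form_sum_recl -(form_sum_const _ (fun i => b (lift ord0 i)) u _ 0).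
  by apply: ler_form_sum.
(* Bound the weighted sum of [p ^ m] from below by the power mean with [q = 1 / D], and from above
   through [f <= e + |g|], [p ^ m <= 1] and [step]. *)
have main : tau * U * D ^- m <= V * E + k ^+ m * (T + U ^+ m * (V * E)).
  apply: (@le_trans _ _ (tau * \sum_x u x * p x ^+ m)).
    rewrite -mulrA ler_wpM2l // -exprVn; apply: power_mean => //.
      by rewrite invr_ge0 ltW.
    apply: le_trans pavg; rewrite ler_wpM2l ?(ltW U0) // lef_pV2 ?posrE ?ltr0Sn //.
  apply: (@le_trans _ _ (\sum_x u x * (e x + p x ^+ m * cabs (g x)))).
    rewrite mulr_sumr; apply: ler_sum => x _; rewrite mulrA.
    apply: (le_trans (ler_wpM2r (exprn_ge0 m (p0 x)) (ftau x))).
    rewrite -mulrA ler_wpM2l //.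
    have pm1 : p x ^+ m <= 1 by rewrite exprn_ile1.
    have pm0 : 0 <= p x ^+ m by rewrite exprn_ge0.
    have : f x <= e x + cabs (g x).
      rewrite -[f x]ger0_norm // -cabs_real -[X in cabs X <= _](subrK (g x)).
      exact: cabsD.
    have := cabs_ge0 ((f x)%:C%C - g x); rewrite -/(e x) => e0 fx.
    apply: (le_trans (ler_wpM2r pm0 fx)).
    by rewrite mulrDl [cabs (g x) * _]mulrC lerD2r ler_piMr.
  under eq_bigr do rewrite mulrDr.
  rewrite big_split /=; apply: lerD => //.
  apply: le_trans (ler_wpM2l (exprn_ge0 m k0) GT).
  rewrite form_sumS mulr_sumr; apply: ler_sum => x _.
  by rewrite add0r [leRHS]mulrCA ler_wpM2l.
have Dm : 0 < D ^+ m by rewrite exprn_gt0.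
have UDm : 0 < (U / D) ^+ m by rewrite exprn_gt0 ?divr_gt0.
have T0 : 0 <= T.
  by apply: sumr_ge0 => x _; rewrite mulr_ge0 ?prodr_ge0.
have TU : 0 <= T + U ^+ m * (V * E).
  by rewrite addr_ge0 // !mulr_ge0 // exprn_ge0 // ltW.
have kDm : k ^+ m <= (D / U) ^+ m by rewrite lerXn2r // nnegrE divr_ge0 // ltW.
have := le_trans main (lerD (lexx _) (ler_wpM2r TU kDm)).
rewrite -(ler_pM2l UDm) => /le_trans h.
rewrite mulrBr lerBlDr; apply: h.
rewrite le_eqVlt; apply/orP; left; apply/eqP.
rewrite !expr_div_n; field.
by rewrite !expf_neq0 ?gt_eqF.
Qed.


End Counting.

(** * Approximation by the leading Fourier coefficients *)

Section Truncation.
Context {R : realType} {N : nat}.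
Hypothesis N_gt1 : (1 < N)%N.
Implicit Types (f : 'Z_N -> R) (lam : seq R[i]).

(** Coefficients may coincide, so the permutation of values is lifted to one of frequencies through
    indices. *)
Lemma fourier_listing_frequencies f lam : fourier_listing f lam ->
  exists2 rs : seq 'Z_N, perm_eq rs (enum 'Z_N) & lam = [seq fourier f r | r <- rs].
Proof.
case=> /(perm_iotaP 0) [is_ is_perm ->] _; rewrite size_map in is_perm.
exists [seq nth 0 (enum 'Z_N) i | i <- is_].
  by apply/(perm_iotaP 0); exists is_.
rewrite -map_comp; apply/eq_in_map => i.
rewrite (perm_mem is_perm) mem_iota /= add0n => iN.
by rewrite (nth_map 0).
Qed.

Lemma sum_coef (h : R[i] -> R) lam n : size lam = N ->
  \sum_(n.+1 <= j < N.+1) h (coef lam j) = \sum_(z <- drop n lam) h z.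
Proof.
move=> lamN; rewrite big_add1 /= [RHS](big_nth 0) size_drop lamN.
case: (leqP n N) => nN.
  rewrite -{1}[n]add0n big_addn; apply: eq_bigr => i _.
  by rewrite nth_drop addnC.
have -> : (N - n = 0)%N by apply/eqP; rewrite subn_eq0 ltnW.
by rewrite (big_geq (ltnW nN)) big_geq.
Qed.

Lemma truncation f lam n : fourier_listing f lam ->
  exists K (s : 'I_K -> 'Z_N) (c : 'I_K -> R[i]), (K <= n)%N /\
    \sum_x cabs ((f x)%:C%C - \sum_i c i * chi (s i * x)) ^+ 2 =
    N%:R^-1 * \sum_(n.+1 <= j < N.+1) cabs (coef lam j) ^+ 2.
Proof.
move=> /fourier_listing_frequencies [rs rs_perm lamE].
have N0 : N%:R != 0 :> R by rewrite pnatr_eq0 -lt0n ltnW.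
have N0C : N%:R != 0 :> R[i] by rewrite pnatr_eq0 -lt0n ltnW.
have rs_uniq : uniq rs by rewrite (perm_uniq rs_perm) enum_uniq.
have rsN : size rs = N by rewrite (perm_size rs_perm) -cardE card_Zp_N.
(* Fourier inversion uses [chi (r * - x)], hence the negated frequencies. *)
exists (size (take n rs)), (fun i => - nth 0 (take n rs) i),
  (fun i => N%:R^-1 * fourier f (nth 0 (take n rs) i)).
split; first by rewrite size_take_min geq_minl.
rewrite (sum_coef (fun z => cabs z ^+ 2)) ?lamE ?size_map //.
rewrite -map_drop big_map.
(* These are the coefficients of the error: the retained frequencies are set to [0]. *)
pose c (r : 'Z_N) : R[i] := if r \in drop n rs then fourier f r else 0.
transitivity (\sum_x N%:R^-1 ^+ 2 * cabs (\sum_r c r * chi (r * - x)) ^+ 2); last rewrite -mulr_sumr.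
  apply: eq_bigr => x _; rewrite -exprMn; congr (_ ^+ 2).
  have -> : N%:R^-1 = cabs (N%:R^-1 : R[i]).
    have -> : N%:R^-1 = (N%:R^-1 : R)%:C%C by rewrite fmorphV rmorph_nat.
    by rewrite cabs_real ger0_norm // invr_ge0 ler0n.
  rewrite -cabsM; congr cabs.
  pose F r := fourier f r * chi (r * - x).
  have -> : (f x)%:C%C = N%:R^-1 * \sum_r F r by rewrite fourier_inversion // mulKf.
  have -> : \sum_r F r = \sum_(r <- take n rs) F r + \sum_(r <- drop n rs) F r.
    by rewrite -big_cat cat_take_drop (perm_big _ rs_perm) big_enum.
  have -> : \sum_r c r * chi (r * - x) = \sum_(r <- drop n rs) F r.
    rewrite [RHS]big_uniq ?drop_uniq // [RHS]big_mkcond; apply: eq_bigr => r _.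
    by rewrite /c; case: ifP => // _; rewrite mul0r.
  rewrite mulrDr; set A := N%:R^-1 * \sum_(r <- take n rs) F r.
  rewrite [X in _ - X = _](_ : _ = A); first by rewrite addrAC subrr add0r.
  rewrite /A (big_nth 0) big_mkord mulr_sumr; apply: eq_bigr => i _.
  by rewrite /F mulrA; congr (_ * chi _); ring.
have <- : \sum_x cabs (\sum_r c r * chi (r * x)) ^+ 2 =
    \sum_x cabs (\sum_r c r * chi (r * - x)) ^+ 2.
  exact: (reindex_inj (@oppr_inj 'Z_N)).
rewrite parseval //.
rewrite mulrA; congr (_ * _); first by field.
rewrite [RHS]big_uniq ?drop_uniq // [RHS]big_mkcond; apply: eq_bigr => r _.
by rewrite /c; case: ifP => // _; rewrite cabs0 expr0n.
Qed.

Lemma sum_coef_sqr f lam : fourier_listing f lam ->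
  \sum_(1 <= j < N.+1) cabs (coef lam j) ^+ 2 = N%:R * \sum_x f x ^+ 2.
Proof.
move=> /fourier_listing_frequencies [rs rs_perm lamE].
have rsN : size rs = N by rewrite (perm_size rs_perm) -cardE card_Zp_N.
rewrite (sum_coef (fun z => cabs z ^+ 2)) ?lamE ?size_map // drop0 big_map.
by rewrite (perm_big _ rs_perm) big_enum fourier_parseval.
Qed.

End Truncation.

Lemma intr_unit_Zp (N : nat) (z : int) : prime N -> z != 0 -> (`|z| < N)%N ->
  (z%:~R : 'Z_N) \is a GRing.unit.
Proof.
move=> N_prime z0 zN.
have : (`|z|%N%:R : 'Z_N) \is a GRing.unit.
  rewrite unitZpE ?prime_gt1 // prime_coprime // gtnNdvd //.
  by rewrite absz_gt0.
case: z {z0 zN} => n //=; rewrite NegzE mulrNz unitrN //.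
Qed.

(** * Numerical estimates *)

Section Arithmetic.
Context {R : realType}.

(** The constant [1000 ^ (d ^ 2)], with [d = m + 2], absorbs the factor [m ^ (2 m)] coming from
    [D = m k]; the proof rests on [m < 2 ^ m]. *)
Lemma exprn_double_le m : m%:R ^+ (2 * m) * 16 <= 1000 ^+ (m.+2 * m.+2) :> R.
Proof.
have m2 : m%:R ^+ 2 <= 4 ^+ m :> R.
  have -> : 4 = 2 ^+ 2 :> R by ring.
  rewrite exprAC lerXn2r ?nnegrE ?exprn_ge0 ?ler0n //.
  by rewrite -natrX ler_nat ltnW // ltn_expl.
have mm : m%:R ^+ (2 * m) <= 4 ^+ (m * m) :> R.
  by rewrite !exprM lerXn2r ?nnegrE ?exprn_ge0 ?ler0n.
have -> : 16 = 4 ^+ 2 :> R by ring.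
apply: (le_trans (ler_wpM2r _ mm)); first by rewrite exprn_ge0.
rewrite -exprD; apply: (@le_trans _ _ (1000 ^+ (m * m + 2))).
  by apply: lerXn2r; rewrite ?nnegrE; lra.
by apply: ler_weXn2l; [lra | lia].
Qed.

(** Drop [L >= 1] and raise the lower bound on [k] to the power [eps * d]. *)
Lemma powR_opp_eps_d_le k theta eps m (L : R) :
  0 < k -> 0 < theta -> 0 < eps -> 1 <= L ->
  1000 `^ (m.+2%:R * eps^-1) * theta `^ (- (eps * m.+2%:R)^-1) * L <= k ->
  k `^ (- (eps * m.+2%:R)) * 1000 ^+ (m.+2 * m.+2) <= theta.
Proof.
move=> k0 th0 e0 L1 hk.
have ed : 0 < eps * m.+2%:R by rewrite mulr_gt0 ?ltr0n.
set A := 1000 `^ _ in hk; set B := theta `^ _ in hk.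
have A0 : 0 <= A by exact: powR_ge0.
have B0 : 0 <= B by exact: powR_ge0.
have ABk : A * B <= k by apply: le_trans hk; rewrite ler_peMr ?mulr_ge0.
have AB0 : A * B \is Num.nneg by rewrite nnegrE mulr_ge0.
have kn : k \is Num.nneg by rewrite nnegrE ltW.
have := ge0_ler_powR (ltW ed) AB0 kn ABk.
rewrite powRM // /A /B -!powRrM mulNr mulVf ?gt_eqF // powR_inv1 ?(ltW th0) //.
have -> : m.+2%:R * eps^-1 * (eps * m.+2%:R) = (m.+2 * m.+2)%:R.
  by rewrite natrM; field; rewrite gt_eqF.
rewrite powR_mulrn; last by lra.
move=> h; rewrite powRN.
by rewrite mulrC ler_pdivrMr ?powR_gt0 // mulrC -ler_pdivrMr.
Qed.

(* The choice [E = 2 sqrt eta sqrt U], [eta = k ^ (- (4 + 10 eps) m)], makes the error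
   terms of [solutions_lower_bound] at most half of its main term. *)
Lemma final_estimate (m : nat) (k theta eps U T : R)
    (d : R := m.+2%:R) (D := m%:R * k) (V := Num.sqrt U) :
  (0 < m)%N -> 1 <= k -> 0 < eps -> 0 < theta <= 1 -> 0 < U ->
  0 <= T <= 2 * U ->
  k `^ (- (eps * m.+2%:R)) * 1000 ^+ (m.+2 * m.+2) <= theta ->
  10^-1 * 4 ^- m.+2 * k `^ (- (2 * (d - 2)) - 2 * eps * (d - 3 / 2)) *
      theta * T ^+ m.+1 <
  (U / D) ^+ m * (theta / 2 * U * D ^- m -
     V * (2 * k `^ (- ((2 + 5 * eps) * m%:R)) * V) * (1 + D ^+ m)).
Proof.
move=> m0 k1 e0 /andP[th0 th1] U0 /andP[T0 TU] hw.
have k0 : 0 < k by lra.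
have kn0 : k != 0 by rewrite gt_eqF.
have mR : 1 <= m%:R :> R by rewrite ler1n.
have dm : d = m%:R + 2 by rewrite /d -[m.+2]addn2 natrD.
set w := k `^ (- (eps * m.+2%:R)) in hw; rewrite -/d dm in w hw.
have w0 : 0 < w by exact: powR_gt0.
pose kp := k ^+ (2 * m); have kp0 : 0 < kp by rewrite exprn_gt0.
pose M : R := m%:R ^+ (2 * m); have M1 : 1 <= M by rewrite exprn_ege1.
have M0 : 0 < M by lra.
have Mw : M * w * 16 <= theta.
  apply: le_trans hw; rewrite mulrAC mulrC ler_wpM2l ?(ltW w0) //.
  exact: exprn_double_le.
have kpE : kp = k `^ (2 * m%:R) by rewrite -natrM powR_mulrn // ltW.
(* After cancelling [k ^ (2 m)] the exponents are [- eps (2 m + 1)] here and [- 5 eps m] for [h];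
   both are at most [- eps (m + 2)] as [m >= 1]. *)
set P := k `^ _; have Pw : P * kp <= w.
  rewrite kpE -powRD; last by rewrite kn0 implybT.
  by apply: ler_powR => //; rewrite dm; nra.
set h := k `^ (- ((2 + 5 * eps) * m%:R)); have hw' : h * kp <= w.
  rewrite kpE -powRD; last by rewrite kn0 implybT.
  by apply: ler_powR => //; nra.
have h0 : 0 < h by exact: powR_gt0.
have P0 : 0 < P by exact: powR_gt0.
have D1 : 1 <= D by rewrite /D; nra.
pose Dm := D ^+ m; have Dm1 : 1 <= Dm by rewrite exprn_ege1.
have Dm0 : 0 < Dm by lra.
have DmE : Dm ^+ 2 = M * kp by rewrite /Dm -exprM mulnC exprMn.
have VV : V * (2 * h * V) = 2 * h * U.
  have : V ^+ 2 = U by rewrite sqr_sqrtr // ltW.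
  by move=> <-; ring.
rewrite VV; clear VV.
(* The intermediate value is half of the main term: the error inside the bracket is at most
   [4 M w <= theta / 4]. *)
apply: (@lt_le_trans _ _ (U ^+ m.+1 / (M * kp) * (theta / 4))); last first.
  have -> : (U / D) ^+ m * (theta / 2 * U * D ^- m - 2 * h * U * (1 + Dm)) =
     U ^+ m.+1 / (Dm ^+ 2) * (theta / 2 - 2 * h * (Dm * (1 + Dm))).
    by rewrite -/Dm expr_div_n -/Dm exprS; field; rewrite gt_eqF.
  rewrite DmE ler_wpM2l ?divr_ge0 ?exprn_ge0 ?mulr_ge0 ?(ltW U0) ?(ltW M0) ?(ltW kp0) //.
  have hM : h * (M * kp) <= M * w by rewrite mulrCA ler_wpM2l // ltW.
  have : h * (Dm * (1 + Dm)) <= h * (2 * (M * kp)).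
    by rewrite ler_wpM2l ?(ltW h0) // -DmE expr2; nra.
  by lra.
have TUm : T ^+ m.+1 <= 2 ^+ m.+1 * U ^+ m.+1.
  by rewrite -exprMn lerXn2r ?nnegrE // mulr_ge0 // ltW.
(* The factor [4 ^- d] pays for replacing [T] by [2 U]. *)
have c24 : 4 ^- m.+2 * 2 ^+ m.+1 <= 1 :> R.
  rewrite mulrC ler_pdivrMr ?exprn_gt0 // mul1r -!natrX ler_nat.
  by rewrite (@leq_trans (2 ^ m.+2)) ?leq_exp2l ?leq_exp2r.
have PM : P * M * kp <= 16^-1 by nra.
pose Um := U ^+ m.+1; have Um0 : 0 < Um by rewrite exprn_gt0.
rewrite -/Um in TUm *.
have c4 : 0 < 4 ^- m.+2 :> R by rewrite invr_gt0 exprn_gt0.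
apply: (@le_lt_trans _ _ (10^-1 * P * theta * Um)).
  have -> : 10^-1 * 4 ^- m.+2 * P * theta * T ^+ m.+1 =
     10^-1 * P * theta * (4 ^- m.+2 * T ^+ m.+1) by ring.
  apply: ler_wpM2l; first by rewrite !mulr_ge0 ?invr_ge0 // ltW.
  apply: (le_trans (ler_wpM2l (ltW c4) TUm)); rewrite mulrA.
  by rewrite ler_piMl // ltW.
have PM' : P <= 16^-1 / (M * kp) by rewrite ler_pdivlMr ?mulr_gt0 // mulrA.
have -> : Um / (M * kp) * (theta / 4) = 4^-1 * (M * kp)^-1 * theta * Um by ring.
rewrite ltr_pM2r // ltr_pM2r //.
have : 0 < (M * kp)^-1 by rewrite invr_gt0 mulr_gt0.
by lra.
Qed.

End Arithmetic.

Theorem theorem1 (R : realType) (d : nat) (hd : (3 <= d)%N)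
    (a : 'I_d -> int) (ha : forall i, a i != 0) (ha0 : \sum_(i < d) a i = 0)
    (eps : R) (heps : 0 < eps < 1) :
  exists N0 : nat, forall N : nat, prime N -> (N0 <= N)%N ->
  forall (f : 'Z_N -> R) (theta : R),
    (forall n, 0 <= f n <= 1) ->
    \sum_(n : 'Z_N) f n = theta * N%:R ->
    0 < theta * N%:R ->
  forall lam : seq R[i], fourier_listing f lam ->
  forall k : nat,
    1000 `^ (d%:R * eps^-1) * theta `^ (- (eps * d%:R)^-1) * ln N%:R <= k%:R ->
    k%:R <= (N%:R : R) `^ (11^-1) ->
    \sum_(k <= j < N.+1) cabs (coef lam j) ^+ 2 <
      k%:R `^ (- ((4 + 10 * eps) * (d%:R - 2))) *
        \sum_(1 <= j < N.+1) cabs (coef lam j) ^+ 2 ->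
  10^-1 * 4 ^- d * k%:R `^ (- (2 * (d%:R - 2)) - 2 * eps * (d%:R - 3 / 2))
      * theta * (theta * N%:R) ^+ d.-1
    < \sum_(x : {ffun 'I_d -> 'Z_N} | \sum_(i < d) (a i)%:~R * x i == 0)
        \prod_(i < d) f (x i).
Proof.
case: d hd a ha ha0 => [//|[//|m]] m0 a ha ha0; rewrite !ltnS in m0.
have {heps} e0 : 0 < eps by case/andP: heps.
(* A prime above every [|a i|] makes the coefficients units; [N >= e] gives [ln N >= 1]. *)
exists (maxn (\max_i `|a i|%N).+1 (Num.bound (expR 1 : R))) => N N_prime.
rewrite geq_max => /andP[aN eN] f theta f01 sum_f thN0 lam hlam k hk _ tail.
have N_gt1 := prime_gt1 N_prime.
have NR : 0 < N%:R :> R by rewrite ltr0n prime_gt0.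
have th0 : 0 < theta by rewrite -(pmulr_lgt0 _ NR).
have f0 x : 0 <= f x by case/andP: (f01 x).
have f1 x : f x <= 1 by case/andP: (f01 x).
have th1 : theta <= 1.
  rewrite -(ler_pM2r NR) mul1r -sum_f -[leRHS](_ : \sum_(x : 'Z_N) 1 = _).
    exact: ler_sum.
  by rewrite sumr_const card_Zp_N.
have lnN : 1 <= ln (N%:R : R).
  rewrite -[leLHS]expRK ler_ln ?posrE ?expR_gt0 //.
  apply: le_trans (ltW (archi_boundP (expR_ge0 1))) _.
  by rewrite ler_nat.
have k_gt0 : 0 < k%:R :> R.
  apply: lt_le_trans hk; apply: mulr_gt0; last exact: lt_le_trans lnN.
  by apply: mulr_gt0; apply: powR_gt0; [lra|].
(* Writing [k = n + 1], exactly [n] coefficients are kept and the tail starts at index [k]. *)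
case: k k_gt0 hk tail => [|n] k_gt0 hk tail; first by rewrite ltxx in k_gt0.
have k1 : 1 <= n.+1%:R :> R by rewrite ler1n.
(* The discarded values are below [theta / 2], so [u] keeps at least half of the total mass. *)
pose u x := if theta / 2 <= f x then f x else 0.
have u01 x : 0 <= u x <= f x by rewrite /u; case: ifP; rewrite ?f0 ?lexx.
set U := \sum_x u x.
have TU : theta * N%:R <= 2 * U.
  have : \sum_x f x <= \sum_x (u x + theta / 2).
    apply: ler_sum => x _; rewrite /u; case: (leP (theta / 2)) => h; lra.
  rewrite big_split /= sumr_const card_Zp_N // sum_f -/U -mulr_natr; lra.
have U0 : 0 < U by lra.
have [K [s [c [Kn trunc]]]] := truncation N_gt1 f lam n hlam.
set h := n.+1%:R `^ (- ((2 + 5 * eps) * m%:R)) : R.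
have wle := powR_opp_eps_d_le _ _ _ _ _ k_gt0 th0 e0 lnN hk.
have th01 : 0 < theta <= 1 by rewrite th0.
have TU' : 0 <= theta * N%:R <= 2 * U by rewrite ltW.
have := final_estimate m n.+1%:R theta eps U (theta * N%:R) m0 k1 e0 th01 U0 TU' wle.
move=> /lt_le_trans; apply.
have sum_a : \sum_i (a i)%:~R = 0 :> 'Z_N by rewrite -rmorph_sum ha0.
have unit_a i : ((a i)%:~R : 'Z_N) \is a GRing.unit.
  apply: intr_unit_Zp => //; apply: leq_ltn_trans aN.
  exact: (leq_bigmax i).
have u2 : \sum_x u x ^+ 2 <= Num.sqrt U ^+ 2.
  rewrite sqr_sqrtr ?(ltW U0) //; apply: ler_sum => x _.
  by case/andP: (u01 x) => ux0 uxf; have := f1 x; nra.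
(* With [h ^ 2] the tail ratio, the error is at most [h ^ 2] times the sum of [f ^ 2], which is at
   most [theta N <= 2 U]. *)
have tail2 : \sum_x cabs ((f x)%:C%C - \sum_i c i * chi (s i * x)) ^+ 2 <=
    (2 * h * Num.sqrt U) ^+ 2.
  have h2 : n.+1%:R `^ (- ((4 + 10 * eps) * (m.+2%:R - 2))) = h ^+ 2.
    rewrite -powR_mulrn ?powR_ge0 // -powRrM; congr (_ `^ _).
    by rewrite -[m.+2]addn2 natrD; ring.
  have f2 : \sum_x f x ^+ 2 <= 2 * U.
    apply: le_trans TU; rewrite -sum_f; apply: ler_sum => x _.
    by have := f0 x; have := f1 x; nra.
  rewrite trunc !exprMn sqr_sqrtr ?(ltW U0) //.
  rewrite (sum_coef_sqr N_gt1 _ _ hlam) h2 in tail.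
  rewrite mulrC ler_pdivrMr //; apply: (le_trans (ltW tail)).
  have h20 : 0 <= h ^+ 2 by rewrite sqr_ge0.
  apply: (@le_trans _ _ (h ^+ 2 * (N%:R * (2 * U)))).
    by rewrite !ler_wpM2l ?ler0n.
  have -> : 2 ^+ 2 * h ^+ 2 * U * N%:R = h ^+ 2 * (N%:R * (4 * U)) by ring.
  by rewrite !ler_wpM2l ?ler0n // ler_wpM2r ?(ltW U0) //; lra.
apply: (solutions_lower_bound N_gt1 _ sum_a (unit_a _) (unit_a _) _ s c) => //.
- by lra.
- move=> x; rewrite /u; case: (leP (theta / 2)) => hx; last by rewrite mulr0 mul0r.
  by rewrite mulrC ler_wpM2l.
(* With [D = m k], the bound [K <= k - 1] leaves room for the extra sample point. *)
- by rewrite -natrM ler_nat mulnC ltn_pmul2l.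
Qed.
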